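(* Let $r,t\ge 2$ be integers. The function $F(\rho_1,\dots,\rho_r)=\sum_{i=1}^r\rho_i(1-\rho_i)^t$ on the simplex $\Delta=\{\rho\in\mathbb{R}^r:\rho_i\ge 0 \text{ for all } i,\ \sum_{i=1}^r\rho_i=1\}$ is maximized at an interior critical point. Up to permutation of coordinates, there are at most two possibilities for this maximizing critical point. One is the Turán solution $(1/r,\dots,1/r)$. The only other possibility is the skew solution $(\alpha,\alpha,\dots,\alpha,\beta)$ associated to $a=r-1$ and $b=1$ for which the common value $g(\alpha)=g(\beta)$ is largest (among the skew solutions with $a=r-1$, $b=1$). Moreover, if any skew solution exists (for any $a,b$), then this skew solution (with $a=r-1$, $b=1$) exists.
   Context: Let $f(\rho)=\rho(1-\rho)^t$ and $g(\rho)=f'(\rho)=(1-\rho)^{t-1}(1-(t+1)\rho)$ for $\rho\in[0,1]$. An interior critical point of $F$ on $\Delta$ is a point $\rho\in\Delta$ with all $\rho_i>0$ such that $\nabla F(\rho)=\lambda(1,\dots,1)$ for some $\lambda\in\mathbb{R}$, i.e. $g(\rho_1)=\dots=g(\rho_r)$. Let $\phi_{\min}=g(2/(t+1))$, the minimum of $g$ on $[0,1]$. For integers $a,b\ge 1$ with $a+b=r$, a skew solution associated to $a$ and $b$ is a point $(\alpha,\dots,\alpha,\beta,\dots,\beta)$ with $a$ coordinates equal to $\alpha$ and $b$ coordinates equal to $\beta$, such that $\frac1{t+1}\le\alpha<\frac2{t+1}<\beta\le 1$, $g(\alpha)=g(\beta)=\phi$ for some $\phi\in(\phi_{\min},0]$,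 and $a\alpha+b\beta=1$. The order of coordinates is immaterial since $F$ is symmetric. *)

(* Defs.v *)
From mathcomp Require Import all_boot all_order all_algebra all_fingroup.
From mathcomp Require Import ring.
From mathcomp Require Import all_classical all_reals all_analysis.

Set Implicit Arguments.
Unset Strict Implicit.
Unset Printing Implicit Defensive.

Import Order.TTheory GRing.Theory Num.Theory.
Import numFieldNormedType.Exports.

Local Open Scope classical_set_scope.
Local Open Scope ring_scope.

Section Definitions.
Variable R : realType.

Definition f (t : nat) (x : R) : R := x * (1 - x) ^+ t.

Definition g (t : nat) : R -> R := (f t)^`()%classic.

(* The minimum of [g t] on [0, 1]. *)
Definition phi_min (t : nat) : R := g t (2 / (t%:R + 1)).

Definition F (t : nat) {r : nat} (rho : 'rV[R]_r) : R := \sum_(i < r) f t (rho 0 i).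

Definition in_simplex {r : nat} (rho : 'rV[R]_r) : Prop :=
  (forall i, 0 <= rho 0 i) /\ \sum_(i < r) rho 0 i = 1.

Definition gradient {r : nat} (G : 'rV[R]_r -> R) (rho : 'rV[R]_r) :
  'rV[R]_r := \row_(i < r) 'D_(delta_mx 0 i) G rho.

Definition interior_critical_point (t : nat) {r : nat} (rho : 'rV[R]_r) : Prop :=
  [/\ in_simplex rho,
      forall i, 0 < rho 0 i
    & exists lambda : R, gradient (F t) rho = const_mx lambda].

Definition maximizes_on_simplex (t : nat) {r : nat} (rho : 'rV[R]_r) : Prop :=
  in_simplex rho /\
  forall sigma : 'rV[R]_r, in_simplex sigma -> F t sigma <= F t rho.

Definition turan_point (r : nat) : 'rV[R]_r := const_mx (r%:R)^-1.

Definition two_valued_point (r a : nat) (alpha beta : R) : 'rV[R]_r :=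
  \row_(i < r) (if (i < a)%N then alpha else beta).

(* The pair (alpha, beta) stands for [two_valued_point r a alpha beta], whose
   last b = r - a coordinates are beta. *)
Definition skew_solution (t r a b : nat) (alpha beta : R) : Prop :=
  [/\ [/\ (1 <= a)%N, (1 <= b)%N & (a + b = r)%N],
      [/\ 1 / (t%:R + 1) <= alpha, alpha < 2 / (t%:R + 1),
          2 / (t%:R + 1) < beta & beta <= 1],
      exists phi : R, [/\ phi_min t < phi, phi <= 0, g t alpha = phi
                        & g t beta = phi]
    & a%:R * alpha + b%:R * beta = 1].

(* "Largest" refers to the common value phi = g(alpha) = g(beta). *)
Definition largest_skew_solution (t r : nat) (alpha beta : R) : Prop :=
  skew_solution t r r.-1 1 alpha beta /\
  forall alpha' beta' : R, skew_solution t r r.-1 1 alpha' beta' ->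
    g t alpha' <= g t alpha.

Definition eq_up_to_perm {r : nat} (rho sigma : 'rV[R]_r) : Prop :=
  exists s : 'S_r, rho = col_perm s sigma.

End Definitions.

Arguments turan_point {R} r.

(* Derivatives are total operators in the library: [gE] and [gradient_FE] rule
   out that the ones used above are junk values. *)
Section Facts.
Variable R : realType.

Lemma is_derive_f (t : nat) (x : R) : (0 < t)%N ->
  is_derive x 1 (f t) ((1 - x) ^+ t.-1 * (1 - (t%:R + 1) * x)).
Proof.
case: t => // t _.
have -> : @f R t.+1 = (fun y : R => y) * (cst 1 - (fun y : R => y)) ^+ t.+1.
  by apply/funext => y; rewrite /f !fctE.
apply: is_derive_eq.
rewrite !fctE /= /GRing.scale /= exprS -natr1; ring.
Qed.

Lemma gE (t : nat) (x : R) : (0 < t)%N ->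
  g t x = (1 - x) ^+ t.-1 * (1 - (t%:R + 1) * x).
Proof.
move=> t_gt0; rewrite /g derive1E.
by have D := is_derive_f x t_gt0; rewrite derive_val.
Qed.

Lemma gradient_FE (t r : nat) (rho : 'rV[R]_r) : (0 < t)%N ->
  gradient (F t) rho = \row_(i < r) g t (rho 0 i).
Proof.
move=> t_gt0; apply/rowP => i; rewrite !mxE.
suff D : is_derive (0 : R) (1 : R)
    (fun h : R => F t (h *: delta_mx 0 i + rho)) (g t (rho 0 i)).
  rewrite -(derive_val (is_derive := D)) /derive.
  set u := (u in lim (fmap u _)); set v := (v in _ = lim (fmap v _)).
  suff -> : u = v by [].
  apply/funext => h; rewrite /u /v /=.
  by rewrite scale0r add0r addr0 [h *: 1]mulr1.
have -> : (fun h : R => F t (h *: delta_mx 0 i + rho)) =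
  cst (\sum_(j < r | j != i) f t (rho 0 j)) + (f t \o shift (rho 0 i)).
  apply/funext => h; rewrite /F (bigD1 i) //= !mxE !eqxx mulr1 addrC.
  rewrite !fctE /=; congr (_ + _); apply: eq_bigr => j ji.
  by rewrite !mxE eqxx (negPf ji) mulr0 add0r.
have D1 : is_derive (shift (rho 0 i) 0) 1 (f t) (g t (rho 0 i)).
  by rewrite /= add0r gE//; exact: is_derive_f.
by apply: is_derive_eq; rewrite addr0 mulr1 add0r.
Qed.
End Facts.

(* Main.v *)
Require Import Defs.
From mathcomp Require Import all_boot all_order all_algebra all_fingroup.
From mathcomp Require Import ring lra.
From mathcomp Require Import all_classical all_reals all_analysis.

(** Write T = t + 1, m = 2 / T and A = r - 1. The function f is strictly concave
on [0, m] and strictly convex on [m, 1], because g' has the sign of T x - 2;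
so g decreases strictly on [0, m] and increases strictly on [m, 1].

A maximizer exists by compactness of the simplex. Its shape is found by moving
mass between two coordinates. A zero coordinate can be refilled at a profit,
since f is strictly subadditive ([f_split], [maximizer_gt0]). So the maximizer
is interior and all slopes g(rho_i) agree ([maximizer_equal_slopes]). Two
coordinates beyond m could be spread apart at a profit ([f_spread],
[maximizer_one_large]). As g is injective on [0, m], either all coordinates are
equal, which is the Turan point, or all but one are equal to some alpha < m and
the remaining one is some beta > m: a skew solution with a = r - 1 and b = 1.

The main difficulty is that, among the latter, only the one with the largest
common slope, that is the one with the smallest alpha, can be a maximizer. They are
critical points of the profile h(x) = A f(x) + f(1 - A x), and so is the Turan
value z = 1/r, which exceeds every alpha. Given skew values x < y, the claim is
h(y) < h(x) ([profile_decreases]). Consider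

  L(u) = ln(- g(1 - A u)) - ln(- g(u)),

which has the sign of h'(u) = A (g(u) - g(1 - A u)) and vanishes at x, y and z.
The point of the logarithm is that L' is rational and that its numerator, over a
positive denominator, is a quadratic polynomial Q with Q(1/T) < 0. If L(v) >= 0
for some v between x and y, the mean value theorem on [x, v], [v, y] and [y, z]
gives, from left to right, a point where Q >= 0, one where Q <= 0 and one where
Q = 0; together with Q(1/T) < 0 on the left this is one sign change too many for a
quadratic. So L < 0 and h decreases from x to y.

Now let (alpha, beta) be a skew solution for arbitrary a and b. Trading
all but one of the values beta for alpha gives A alpha + beta <= 1, and then
g(x) - g(1 - A x) is nonnegative at 1/T and nonpositive at alpha. A zero in
between gives a skew solution with b = 1, and the least zero gives the one with
the largest slope ([exists_largest_skew]); injectivity of g on [0, m] makes it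
unique. *)

Import Order.TTheory GRing.Theory Num.Theory.
Import numFieldNormedType.Exports.

Set Implicit Arguments.
Unset Strict Implicit.
Unset Printing Implicit Defensive.

Local Open Scope ring_scope.

(** * Preliminaries *)

Lemma mean_value {R : realType} (h dh : R -> R) (a b : R) : a < b ->
  (forall x, a <= x <= b -> is_derive x 1 h (dh x)) ->
  exists c, a < c < b /\ h b - h a = dh c * (b - a).
Proof.
move=> ab dhP.
have [||c] := @MVT R h dh a b ab.
- by move=> x; rewrite in_itv /= => /andP[ax xb]; apply: dhP; rewrite !ltW.
- apply: derivable_within_continuous => x; rewrite in_itv /= => xab.
  by have [] := dhP x xab.
- by rewrite in_itv /= => cab e; exists c.
Qed.

Lemma derivable_continuous {R : realType} (h dh : R -> R) :
  (forall x : R, is_derive x 1 h (dh x)) -> continuous h.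
Proof.
move=> dhP x; apply: differentiable_continuous; apply/derivable1_diffP.
by have [] := dhP x.
Qed.

(** The signs -, +, -, + at four increasing points would make the third divided
difference of q positive, but that of a quadratic vanishes. *)
Lemma quadratic_sign_changes {R : realDomainType} (c0 c1 c2 x0 x1 x2 x3 : R) :
  let q (x : R) := c0 + c1 * x + c2 * x * x in
  x0 < x1 -> x1 < x2 -> x2 < x3 ->
  0 <= q x1 -> q x2 <= 0 -> 0 <= q x3 -> 0 <= q x0.
Proof.
move=> q h01 h12 h23 q1 q2 q3; rewrite leNgt; apply/negP => q0.
have : q x0 * ((x3 - x2) * (x3 - x1) * (x2 - x1))
     - q x1 * ((x3 - x2) * (x3 - x0) * (x2 - x0))
     + q x2 * ((x3 - x1) * (x3 - x0) * (x1 - x0))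
     - q x3 * ((x2 - x1) * (x2 - x0) * (x1 - x0)) = 0 by rewrite /q; ring.
have : q x0 * ((x3 - x2) * (x3 - x1) * (x2 - x1)) < 0.
  by rewrite nmulr_rlt0// !mulr_gt0// subr_gt0//; lra.
have : 0 <= q x1 * ((x3 - x2) * (x3 - x0) * (x2 - x0)).
  by rewrite !mulr_ge0//; lra.
have : q x2 * ((x3 - x1) * (x3 - x0) * (x1 - x0)) <= 0.
  by rewrite mulr_le0_ge0// !mulr_ge0//; lra.
have : 0 <= q x3 * ((x2 - x1) * (x2 - x0) * (x1 - x0)).
  by rewrite !mulr_ge0//; lra.
lra.
Qed.

Lemma three_le_succ (R : realType) (t : nat) : (2 <= t)%N -> 3 <= t%:R + 1 :> R.
Proof. by move=> ht; have : 2 <= t%:R :> R; [rewrite ler_nat|lra]. Qed.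

(** * The function f and its derivative g *)

Section OneVariable.
Context {R : realType} {t : nat} (ht : (2 <= t)%N).
Local Notation T := (t%:R + 1 : R).
(* the inflection point of [f t], where [g t] is least *)
Local Notation m := (2 / T).

Let t_gt0 : (0 < t)%N. Proof. exact: ltnW. Qed.
Let T_ge3 : 3 <= T. Proof. exact: three_le_succ. Qed.

Lemma inflectionE : T * m = 2.
Proof. by rewrite mulrC divfK//; lra. Qed.

Lemma is_derive_f_g (x : R) : is_derive x 1 (f t) (g t x).
Proof. by rewrite gE//; exact: is_derive_f. Qed.

Lemma is_derive_g (x : R) :
  is_derive x 1 (g t) (t%:R * (1 - x) ^+ t.-2 * (T * x - 2)).
Proof.
have -> : @g R t = (cst 1 - (fun y : R => y)) ^+ t.-1 * (cst 1 - cst T * (fun y : R => y)).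
  by apply/funext => y; rewrite gE// !fctE.
have [k ->] : exists k, t = k.+2 by exists t.-2; rewrite -subn2 -addn2 subnK.
rewrite !succnK.
apply: is_derive_eq.
rewrite !fctE /= /GRing.scale /= !exprS -!natr1; ring.
Qed.

Lemma g_decreasing (x y : R) : 0 <= x -> x < y -> y <= m -> g t y < g t x.
Proof.
have Tm := inflectionE; have T3 := T_ge3; move=> x0 xy ym.
have [c [/andP[xc cy] e]] := mean_value xy (fun z _ => is_derive_g z).
rewrite -subr_lt0 e pmulr_llt0 ?subr_gt0//.
have t0 : 0 < t%:R :> R by rewrite ltr0n.
have Tc : T * c < T * m by rewrite ltr_pM2l//; lra.
have m1 : m < 1 by rewrite ltr_pdivrMr; lra.
by rewrite pmulr_rlt0 ?mulr_gt0 ?exprn_gt0//; lra.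
Qed.

Lemma g_decreasing_le (x y : R) : 0 <= x -> x <= y -> y <= m -> g t y <= g t x.
Proof.
by move=> x0; rewrite le_eqVlt => /predU1P[->//|xy] ym; exact/ltW/g_decreasing.
Qed.

Lemma g_increasing (x y : R) : m <= x -> x < y -> y <= 1 -> g t x < g t y.
Proof.
have Tm := inflectionE; have T3 := T_ge3; move=> mx xy y1.
have [c [/andP[xc cy] e]] := mean_value xy (fun z _ => is_derive_g z).
rewrite -subr_gt0 e pmulr_lgt0 ?subr_gt0//.
have t0 : 0 < t%:R :> R by rewrite ltr0n.
have Tc : T * m < T * c by rewrite ltr_pM2l//; lra.
by rewrite ?mulr_gt0 ?exprn_gt0//; lra.
Qed.

Lemma g_lt0 (x : R) : x < 1 -> (g t x < 0) = (1 < T * x).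
Proof.
move=> x1; rewrite gE// pmulr_rlt0 ?subr_lt0//.
by rewrite exprn_gt0// subr_gt0.
Qed.

Lemma g_lt0_right (y : R) : m < y -> y < 1 -> g t y < 0.
Proof.
have T3 := T_ge3; have Tm := inflectionE => my y1; rewrite g_lt0//.
by have : T * m < T * y; [rewrite ltr_pM2l//; lra|lra].
Qed.

(** Both 1 - x and 1 - y exceed the factor 1 - (x + y) of the unsplit coordinate. *)
Lemma f_split (x y : R) : 0 < x -> 0 < y -> x + y <= 1 -> f t (x + y) < f t x + f t y.
Proof.
move=> x0 y0 xy1; rewrite /f mulrDl ltrD// ltr_pM2l// ltrXn2r -?lt0n//; lra.
Qed.

(** On the convex side of m, pushing the smaller of two coordinates down to m and
the larger one up by the same amount gains. *)
Lemma f_spread (x y : R) : m < x -> x <= y -> x + y <= 1 ->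
  f t x + f t y < f t m + f t (x + y - m).
Proof.
move=> mx xy xy1.
have T3 := T_ge3.
have m0 : 0 < m by rewrite divr_gt0//; lra.
have [c [/andP[mc cx] e1]] := mean_value mx (fun z _ => is_derive_f_g z).
have yy' : y < x + y - m by lra.
have [d [/andP[yd dy] e2]] := mean_value yy' (fun z _ => is_derive_f_g z).
have gcd : g t c < g t d by apply: g_increasing; lra.
have : g t c * (x - m) < g t d * (x - m) by rewrite ltr_pM2r ?subr_gt0.
rewrite (_ : x + y - m - y = x - m) in e2; last by ring.
lra.
Qed.

End OneVariable.

(** * Comparing the critical points of the profile *)

Definition logratio {R : realType} (t : nat) (A x : R) : R :=
  ln (- g t (1 - A * x)) - ln (- g t x).

(** The numerator of the derivative of [logratio] at x over the denominator
x (1 - x) (T x - 1) (T (1 - A x) - 1): a priori a cubic, but its terms of degree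
three cancel. *)
Definition logratio_slope_num {R : realType} (t : nat) (A x : R) : R :=
  let T := t%:R + 1 in
  (T - 2) * (T * x - 1) * (T * (1 - A * x) - 1) - T * (T - 1 - A) * x * (1 - x).

Section Profile.
Context {R : realType} {t : nat} (ht : (2 <= t)%N).
Local Notation T := (t%:R + 1 : R).
Local Notation Q := (logratio_slope_num t).

Let t_gt0 : (0 < t)%N. Proof. exact: ltnW. Qed.
Let T_ge3 : 3 <= T. Proof. exact: three_le_succ. Qed.

Lemma is_derive_profile (A x : R) :
  is_derive x 1 (fun y => A * f t y + f t (1 - A * y))
            (A * (g t x - g t (1 - A * x))).
Proof.
have d1 := is_derive_f_g ht x.
have d2 := is_derive_f_g ht (1 - A * x).
have -> : (fun y => A * f t y + f t (1 - A * y)) =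
    cst A * f t + (f t \o (cst 1 - cst A * (fun y : R => y))).
  by apply/funext => y; rewrite !fctE.
apply: is_derive_eq.
rewrite !fctE /= /GRing.scale /=; ring.
Qed.

(** The logarithmic derivative of g is rational: the power of 1 - x cancels. *)
Lemma is_derive_ln_g (x : R) : x < 1 -> 1 < T * x ->
  is_derive x 1 (fun y => ln (- g t y))
    ((T - 1) * (2 - T * x) / ((1 - x) * (T * x - 1))).
Proof.
move=> x1 Tx.
have d1 := is_derive_g ht x.
have g0 : 0 < (- g t) x by rewrite fctE oppr_gt0 g_lt0.
have d2 := is_derive1_ln g0.
have -> : (fun y => ln (- g t y)) = @ln R \o (- g t) by apply/funext => y.
apply: is_derive_eq.
rewrite fctE gE//.
have [k tE] : exists k, t = k.+2 by exists t.-2; rewrite -subn2 -addn2 subnK.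
rewrite tE !succnK exprS /GRing.scale /= -!natr1.
have p0 : (1 - x) ^+ k != 0 by rewrite expf_neq0//; lra.
move: Tx; rewrite tE -!natr1 => Tx.
by field; rewrite p0 andbT; apply/and3P; split; lra.
Qed.

Lemma is_derive_logratio (A x : R) : 0 < A -> 0 < x -> x < 1 -> 1 < T * x ->
  1 < T * (1 - A * x) ->
  is_derive x 1 (logratio t A)
    (logratio_slope_num t A x / (x * (1 - x) * (T * x - 1) * (T * (1 - A * x) - 1))).
Proof.
move=> A0 x0 x1 Tx Tb.
have Ax0 : 0 < A * x by rewrite mulr_gt0.
have d1 := is_derive_ln_g x1 Tx.
have b1 : 1 - A * x < 1 by lra.
have d2 := is_derive_ln_g b1 Tb.
have -> : logratio t A = ((fun y => ln (- g t y)) \o (cst 1 - cst A * (fun y : R => y)))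
   - (fun y => ln (- g t y)).
  by apply/funext => y; rewrite !fctE.
apply: is_derive_eq.
rewrite !fctE /= /GRing.scale /= /logratio_slope_num.
by field; do 4?[apply/andP; split]; lra.
Qed.

(** This is what singles out the largest slope: both x and y are critical points
of the profile u |-> A f(u) + f(1 - A u), and so is z = 1 / (A + 1), where
u = 1 - A u. A quadratic numerator Q leaves [logratio] no room for a nonnegative
value between x and y, so the profile decreases from x to y. *)
Lemma profile_decreases (A x y : R) : 0 < A -> 1 < T * x -> x < y ->
  (A + 1) * y < 1 -> g t x = g t (1 - A * x) -> g t y = g t (1 - A * y) ->
  A * f t y + f t (1 - A * y) < A * f t x + f t (1 - A * x).
Proof.
have T3 := T_ge3.
move=> A0 Tx xy Ay.
have x0 : 0 < x by rewrite -(@pmulr_rgt0 _ T); lra.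
set z := (A + 1)^-1.
have zE : (A + 1) * z = 1 by rewrite divff//; lra.
have yz : y < z by rewrite -(@ltr_pM2l _ (A + 1)) ?zE//; lra.
have zA : z = 1 - A * z by rewrite -zE; ring.
(* from (A + 1) x < 1 < T x *)
have AT : A < T - 1.
  have : (A + 1) * x < (A + 1) * y by rewrite ltr_pM2l//; lra.
  move=> h; have : (A + 1) * x < T * x by lra.
  rewrite ltr_pM2r//; lra.
(* at 1 / T only the second product of Q survives, and A < T - 1 *)
have Q0 : Q A T^-1 < 0.
  have TV : T * T^-1 = 1 by rewrite divff//; lra.
  have V0 : 0 < T^-1 by rewrite invr_gt0; lra.
  have V1 : T^-1 < 1 by rewrite invf_lt1; lra.
  rewrite /logratio_slope_num TV subrr mulr0 mul0r sub0r oppr_lt0.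
  by rewrite !mulr_gt0//; lra.
(* the coefficients of Q, as a quadratic in u *)
have QE u : - (T - 2) * (T - 1) +
  ((T - 2) * (T * (T - 1) + T * A) - T * (T - 1 - A)) * u +
  (- (T - 2) * T * T * A + T * (T - 1 - A)) * u * u = Q A u.
  by rewrite /logratio_slope_num; ring.
have Vx : T^-1 < x by rewrite -(@ltr_pM2l _ T) ?divff//; lra.
have dom u : x <= u <= z ->
    [/\ 0 < u, u < 1, 1 < T * u, 1 < T * (1 - A * u) & 1 - A * u < 1].
  move=> /andP[xu uz].
  have Tu : T * x <= T * u by rewrite ler_pM2l//; lra.
  have Au : A * u <= A * z by rewrite ler_pM2l.
  have Tu' : T * z <= T * (1 - A * u) by rewrite ler_pM2l//; lra.
  have Tz : T * u <= T * z by rewrite ler_pM2l//; lra.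
  have Au0 : 0 < A * u by rewrite mulr_gt0//; lra.
  have Az : 0 < A * z by rewrite mulr_gt0//; lra.
  by split; lra.
have dL u : x <= u <= z -> is_derive u 1 (logratio t A)
    (Q A u / (u * (1 - u) * (T * u - 1) * (T * (1 - A * u) - 1))).
  by move=> /dom[? ? ? ? ?]; exact: is_derive_logratio.
have den u : x <= u <= z ->
    0 < u * (1 - u) * (T * u - 1) * (T * (1 - A * u) - 1).
  by move=> /dom[? ? ? ? ?]; rewrite !mulr_gt0// subr_gt0.
move=> gx gy.
have Lx : logratio t A x = 0 by rewrite /logratio -gx subrr.
have Ly : logratio t A y = 0 by rewrite /logratio -gy subrr.
have Lz : logratio t A z = 0 by rewrite /logratio -zA subrr.
(* the mean value theorem, up to a positive factor k *)
have slope a b : x <= a -> a < b -> b <= z -> exists c k,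
    [/\ a < c, c < b, 0 < k & Q A c = (logratio t A b - logratio t A a) * k].
  move=> xa ab bz.
  have [|c [/andP[ac cb] e]] := mean_value (h := logratio t A) ab
      (dh := fun u => Q A u / (u * (1 - u) * (T * u - 1) * (T * (1 - A * u) - 1))).
    by move=> u /andP[au ub]; apply: dL; rewrite (le_trans xa)//= (le_trans ub).
  have D0 : 0 < c * (1 - c) * (T * c - 1) * (T * (1 - A * c) - 1).
    by apply: den; rewrite (le_trans xa (ltW ac))//= (le_trans (ltW cb)).
  exists c, (c * (1 - c) * (T * c - 1) * (T * (1 - A * c) - 1) / (b - a)).
  split=> //; first by rewrite divr_gt0// subr_gt0.
  by rewrite e mulrA -[_ * (b - a) * _]mulrAC divfK ?gt_eqF// mulfK// gt_eqF// subr_gt0.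
have Lneg v : x < v -> v < y -> logratio t A v < 0.
  move=> xv vy; rewrite ltNge; apply/negP => Lv.
  have vz := lt_trans vy yz.
  (* the signs of Q at 1 / T < c1 < c2 < c3 are -, >= 0, <= 0, 0 *)
  have [c1 [k1 [xc1 c1v k10 e1]]] := slope x v (lexx x) xv (ltW vz).
  have [c2 [k2 [vc2 c2y k20 e2]]] := slope v y (ltW xv) vy (ltW yz).
  have [c3 [k3 [yc3 c3z k30 e3]]] := slope y z (ltW xy) yz (lexx z).
  rewrite Lx subr0 in e1; rewrite Ly sub0r in e2.
  rewrite Ly Lz subrr mul0r in e3.
  suff : 0 <= Q A T^-1 by rewrite leNgt Q0.
  rewrite -QE; apply: (@quadratic_sign_changes R _ _ _ _ c1 c2 c3); rewrite ?QE.
  - exact: lt_trans xc1.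
  - exact: lt_trans vc2.
  - exact: lt_trans yc3.
  - by rewrite e1 mulr_ge0// ltW.
  - by rewrite e2 mulNr oppr_le0 mulr_ge0// ltW.
  - by rewrite e3.
have [c [/andP[xc cy] e]] := mean_value xy (fun u _ => is_derive_profile A u).
rewrite -subr_lt0 e pmulr_llt0 ?subr_gt0// pmulr_rlt0// subr_lt0.
have [|c0 c1 Tc TAc Ac1] := dom c; first by rewrite (ltW xc)/= (ltW (lt_trans cy yz)).
have := Lneg c xc cy; rewrite subr_lt0 ltr_ln ?ltrN2 // posrE oppr_gt0 g_lt0//.
Qed.

End Profile.

(** * Maximizers on the simplex *)

Section Simplex.
Context {R : realType} {r : nat}.
Implicit Types rho : 'rV[R]_r.

Definition set_two_coords rho (i j : 'I_r) (u v : R) : 'rV[R]_r :=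
  \row_k (if k == i then u else if k == j then v else rho 0 k).

Lemma sum_set_two_coords (G : R -> R) rho (i j : 'I_r) (u v : R) : i != j ->
  \sum_k G (set_two_coords rho i j u v 0 k) =
  \sum_k G (rho 0 k) + (G u + G v) - (G (rho 0 i) + G (rho 0 j)).
Proof.
move=> ij; have ji : j != i by rewrite eq_sym.
rewrite (bigD1 i)//= (bigD1 j)//= [in RHS](bigD1 i)//= [in RHS](bigD1 j)//=.
rewrite !mxE !eqxx (negPf ji).
rewrite (eq_bigr (fun k => G (rho 0 k))); first by ring.
by move=> k /andP[ki kj]; rewrite mxE (negPf ki) (negPf kj).
Qed.

Lemma in_simplex_pair rho (i j : 'I_r) : i != j -> in_simplex rho ->
  rho 0 i + rho 0 j <= 1.
Proof.
move=> ij [rho0 <-]; rewrite (bigD1 i)//= (bigD1 j) 1?eq_sym//= addrA lerDl.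
exact: sumr_ge0.
Qed.

Lemma in_simplex_le1 rho (i : 'I_r) : in_simplex rho -> rho 0 i <= 1.
Proof.
move=> [rho0 <-]; rewrite (bigD1 i)//= lerDl; exact: sumr_ge0.
Qed.

Lemma compact_simplex : compact [set rho : 'rV[R]_r | in_simplex rho]%classic.
Proof.
have cc i : continuous (fun rho : 'rV[R]_r => rho 0 i) by exact: coord_continuous.
have cube : compact
    [set rho : 'rV[R]_r | forall i, (`[0, 1]%classic : set R) (rho 0 i)]%classic.
  by apply: (@rV_compact R r (fun=> `[0, 1]%classic)) => i; exact: segment_compact.
apply: subclosed_compact cube _; last first.
  by move=> rho rhoS i /=; rewrite in_itv/= in_simplex_le1// andbT; case: rhoS.
have -> : [set rho : 'rV[R]_r | in_simplex rho]%classic =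
    ((\bigcap_(i in setT) [set rho : 'rV[R]_r | 0 <= rho 0 i]) `&`
    [set rho | \sum_i rho 0 i = 1])%classic.
  by apply/seteqP; split=> rho [h0 h1]; split=> //= i; [move=> _|]; apply: h0.
apply: closedI.
  apply: closed_bigI => i _.
  by apply: (preimage_closed _ (@closed_ge R 0)) => y _; exact: cc.
apply: (preimage_closed _ (@closed_eq R 1)) => y _.
exact: (@continuous_big R _ +%R 0 xpredT (@add_continuous R) _ _ _ (fun i _ => cc i)).
Qed.

Lemma exists_maximizer (t : nat) : (0 < t)%N -> (0 < r)%N ->
  exists rho : 'rV[R]_r, maximizes_on_simplex t rho.
Proof.
move=> t0 r0.
have [||rho rhoS rhoM] := @EVT_max_rV R r (F t) [set rho | in_simplex rho]%classic _ compact_simplex.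
- exists (turan_point r); split=> [i|]; first by rewrite mxE invr_ge0 ler0n.
  under eq_bigr do rewrite mxE.
  by rewrite sumr_const card_ord -[_ *+ _]mulr_natr mulVf// pnatr_eq0 -lt0n.
- apply: continuous_subspaceT.
  apply: (@continuous_big R _ +%R 0 xpredT (@add_continuous R)) => i _ rho.
  apply: (@continuous_comp _ _ _ (fun v : 'rV[R]_r => v 0 i) (f t)).
    exact: coord_continuous.
  exact: (derivable_continuous (fun x => is_derive_f x t0)).
exists rho; split; first by move: rhoS; rewrite inE.
by move=> sigma sS; apply: rhoM; rewrite inE.
Qed.

End Simplex.

Section Maximizers.
Context {R : realType} {r t : nat} (ht : (2 <= t)%N).
Context (rho : 'rV[R]_r) (rho_max : maximizes_on_simplex t rho).
Local Notation T := (t%:R + 1 : R).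
Local Notation m := (2 / T).

(** F is a sum over the coordinates, so moving mass between two of them compares
two terms only. *)
Lemma maximizer_exchange (i j : 'I_r) (u v : R) : i != j -> 0 <= u -> 0 <= v ->
  u + v = rho 0 i + rho 0 j -> f t u + f t v <= f t (rho 0 i) + f t (rho 0 j).
Proof.
move=> ij u0 v0 uv; have [[rho0 rho1] rhoM] := rho_max.
have : in_simplex (set_two_coords rho i j u v).
  split=> [k|]; first by rewrite mxE; case: ifP => // _; case: ifP.
  by rewrite (sum_set_two_coords id)// rho1 /= uv addrK.
by move=> /rhoM; rewrite /F sum_set_two_coords//; lra.
Qed.

(** A zero coordinate could take half of a positive one, with a gain by [f_split]. *)
Lemma maximizer_gt0 (i : 'I_r) : 0 < rho 0 i.
Proof.
have [[rho0 rho1] _] := rho_max.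
rewrite lt0r rho0 andbT; apply/negP => /eqP ri0.
have [j rj] : exists j, 0 < rho 0 j.
  apply: contrapT => h; move: rho1; rewrite big1 => [/esym/eqP|k _].
    by rewrite oner_eq0.
  by apply/eqP; rewrite eq_le rho0 andbT leNgt; apply/negP => rk; apply: h; exists k.
have ij : i != j by apply: contraTneq rj => <-; rewrite ri0 ltxx.
have h0 : 0 < rho 0 j / 2 by rewrite divr_gt0.
have hh : rho 0 j / 2 + rho 0 j / 2 = rho 0 j by rewrite -splitr.
have j1 := in_simplex_le1 j rho_max.1.
have := maximizer_exchange ij (ltW h0) (ltW h0).
rewrite ri0 add0r hh => /(_ erefl); rewrite [f t 0]/f mul0r add0r leNgt.
by rewrite -[X in f t X < _]hh f_split// hh.
Qed.

(** Lagrange multipliers for two coordinates: with their sum x + y kept fixed, the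
value x maximizes u |-> f(u) + f(x + y - u) in the interior of [0, x + y]. *)
Lemma maximizer_equal_slopes (i j : 'I_r) : g t (rho 0 i) = g t (rho 0 j).
Proof.
have [->//|ij] := eqVneq i j.
have ri := maximizer_gt0 i; have rj := maximizer_gt0 j.
set x : R := rho 0 i in ri *; set y : R := rho 0 j in rj *.
have dh (u : R) : is_derive u 1 (fun z : R => f t z + f t (x + y - z)) (g t u - g t (x + y - u)).
  have d1 := is_derive_f_g ht u.
  have d2 := is_derive_f_g ht (x + y - u).
  have -> : (fun z : R => f t z + f t (x + y - z)) =
      f t + (f t \o (cst (x + y) - (fun z : R => z))).
    by apply/funext => z; rewrite !fctE.
  by apply: is_derive_eq; rewrite /GRing.scale /=; ring.
have xy0 : 0 < x + y by rewrite addr_gt0.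
have [||d0 e0] := @derive1_at_max R _ 0 (x + y) x (ltW xy0) (fun u _ => @ex_derive _ _ _ _ _ _ _ (dh u)).
- by rewrite in_itv/= ri ltrDl.
- move=> u; rewrite in_itv/= => /andP[u0 uxy].
  rewrite [X in _ <= _ + f t X](_ : _ = y); last by ring.
  by apply: maximizer_exchange => //; [exact: ltW|lra|rewrite -/x -/y; ring].
have [_ e1] := dh x; move: e1; rewrite e0 => /esym/eqP; rewrite subr_eq0 => /eqP ->.
by congr g; ring.
Qed.

Lemma maximizer_critical : interior_critical_point t rho.
Proof.
split; [exact: rho_max.1|exact: maximizer_gt0|].
have [r0|r0] := posnP r.
  by exists 0; apply/rowP => i; exfalso; case: i => k; rewrite r0.
exists (g t (rho 0 (Ordinal r0))); apply/rowP => i.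
by rewrite gradient_FE ?(ltnW ht)// !mxE; exact: maximizer_equal_slopes.
Qed.

Lemma maximizer_one_large (i j : 'I_r) : m < rho 0 i -> m < rho 0 j -> i = j.
Proof.
move=> mi mj; apply/eqP/negPn/negP => ij.
wlog le_ij : i j mi mj ij / rho 0 i <= rho 0 j.
  move=> W; case/orP: (le_total (rho 0 i) (rho 0 j)) => ?.
    exact: (W i j).
  by apply: (W j i) => //; rewrite eq_sym.
have ij1 := in_simplex_pair ij rho_max.1.
have m0 : 0 < m by rewrite divr_gt0// ltr_wpDl.
have := f_spread ht mi le_ij ij1; apply/negP; rewrite -leNgt.
by apply: maximizer_exchange => //; [lra|ring].
Qed.

End Maximizers.

(** * Skew solutions *)

Section Skew.
Context {R : realType} {r t : nat} (hr : (2 <= r)%N) (ht : (2 <= t)%N).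
Local Notation T := (t%:R + 1 : R).
Local Notation m := (2 / T).
Local Notation A := (r.-1%:R : R).

Let T_ge3 : 3 <= T.
Proof. exact: three_le_succ. Qed.

Let A_gt0 : 0 < A. Proof. by rewrite ltr0n -ltnS prednK// ltnW. Qed.

Lemma predrE : A + 1 = r%:R.
Proof. by rewrite natr1 prednK// ltnW. Qed.

Lemma inv_succ_le (x : R) : (1 / T <= x) = (1 <= T * x).
Proof. by rewrite ler_pdivrMr 1?mulrC//; have := T_ge3; lra. Qed.

(** The boundary slope phi = 0 does not occur: it would need beta = 1, hence
alpha = 0. This makes all the bounds strict, as [profile_decreases] requires, and
the condition on phi becomes a consequence of the bounds. *)
Lemma skewP (alpha beta : R) : skew_solution t r r.-1 1 alpha beta <->
  [/\ [/\ 1 < T * alpha, alpha < m, m < beta & beta < 1],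
      g t alpha = g t beta & beta = 1 - A * alpha].
Proof.
have T3 := T_ge3; have Tm := @inflectionE R t; have A0 := A_gt0.
split=> [[_ [Ta am mb b1] [phi [_ _ ga gb]]]|[[Ta am mb b1] gab bE]].
  rewrite inv_succ_le in Ta; rewrite mul1r => e.
  have a0 : 0 < alpha by rewrite -(@pmulr_rgt0 _ T); lra.
  have b1' : beta < 1 by have := mulr_gt0 A0 a0; lra.
  split; [split=> //|by rewrite ga gb|by lra].
  have m1 : m < 1 by lra.
  have a1 : alpha < 1 by lra.
  by rewrite -(g_lt0 ht a1) ga -gb g_lt0_right.
have m1 : m < 1 by lra.
have a0 : 0 < alpha by rewrite -(@pmulr_rgt0 _ T); lra.
split.
- by rewrite addn1 prednK ?(ltnW hr)//; split=> //; rewrite -ltnS prednK// ltnW.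
- by rewrite inv_succ_le; split=> //; exact: ltW.
- exists (g t alpha); split=> //; first by rewrite /phi_min g_decreasing// ltW.
  by rewrite ltW// g_lt0//; lra.
- by rewrite bE mul1r; ring.
Qed.

Lemma largest_skew_unique (alpha beta alpha' beta' : R) :
  largest_skew_solution t r alpha beta ->
  largest_skew_solution t r alpha' beta' -> alpha = alpha' /\ beta = beta'.
Proof.
move=> [s l] [s' l'].
have e : g t alpha = g t alpha' by apply/eqP; rewrite eq_le (l' _ _ s) (l _ _ s').
move/skewP: s => [[Ta am _ _] _ ->]; move/skewP: s' => [[Ta' am' _ _] _ ->].
have T3 := T_ge3.
have a0 : 0 < alpha by rewrite -(@pmulr_rgt0 _ T); lra.
have a0' : 0 < alpha' by rewrite -(@pmulr_rgt0 _ T); lra.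
suff -> : alpha = alpha' by [].
have [lt|lt|//] := ltgtP alpha alpha'.
  by have := g_decreasing ht (ltW a0) lt (ltW am'); rewrite e ltxx.
by have := g_decreasing ht (ltW a0') lt (ltW am); rewrite e ltxx.
Qed.

(** All zeros of D to the left of the given alpha are skew values, because
1 - A x stays above beta there. So the least zero in [1/T, alpha] has the
largest slope among all skew solutions with b = 1. *)
Lemma exists_largest_skew (a b : nat) (alpha beta : R) :
  skew_solution t r a b alpha beta ->
  exists alpha' beta' : R, largest_skew_solution t r alpha' beta'.
Proof.
move=> [[a1 b1 abr] [Ta am mb be1] [phi [_ _ ga gb]] sum1].
have T3 := T_ge3; have Tm := @inflectionE R t; have A0 := A_gt0.
have a0 : 0 < alpha by rewrite (lt_le_trans _ Ta)// divr_gt0//; lra.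
have m1 : m < 1 by lra.
(* trading b - 1 of the values beta for the smaller alpha *)
have Ab : beta <= 1 - A * alpha.
  have AE : A = a%:R + b%:R - 1 by rewrite -natrD abr -predrE addrK.
  have b1R : 1 <= b%:R :> R by rewrite (ler_nat _ 1).
  have : 0 <= (b%:R - 1) * (beta - alpha) by rewrite mulr_ge0//; lra.
  rewrite AE; lra.
have beta_range x : 1 / T <= x <= alpha -> beta <= 1 - A * x < 1.
  move=> /andP[Tx xa].
  have x0 : 0 < x by rewrite (lt_le_trans _ Tx)// divr_gt0//; lra.
  have := mulr_gt0 A0 x0; have : A * x <= A * alpha by rewrite ler_pM2l.
  lra.
pose D x : R := g t x - g t (1 - A * x).
have Dcont : continuous D.
  apply: (@derivable_continuous _ _ (fun x =>
    t%:R * (1 - x) ^+ t.-2 * (T * x - 2) +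
    A * (t%:R * (1 - (1 - A * x)) ^+ t.-2 * (T * (1 - A * x) - 2)))) => x.
  have d1 := is_derive_g ht x; have d2 := is_derive_g ht (1 - A * x).
  have -> : D = g t - (g t \o (cst 1 - cst A * (fun y : R => y))).
    by apply/funext => y; rewrite !fctE.
  by apply: is_derive_eq; rewrite !fctE /= /GRing.scale /=; ring.
have [x1 x1I Dx1] : exists2 x, x \in `[1 / T, alpha] & D x = 0.
  have D1 : 0 <= D (1 / T).
    have /andP[h1 h2] : beta <= 1 - A * (1 / T) < 1 by apply: beta_range; rewrite lexx.
    have -> : D (1 / T) = - g t (1 - A * (1 / T)).
      by rewrite /D [g t (1 / T)]gE ?(ltnW ht)// mul1r divff ?subrr ?mulr0 ?sub0r//; lra.
    by rewrite oppr_ge0 ltW// g_lt0_right//; lra.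
  have D2 : D alpha <= 0.
    have /andP[h1 h2] : beta <= 1 - A * alpha < 1 by apply: beta_range; rewrite lexx Ta.
    rewrite subr_le0 ga -gb; move: h1; rewrite le_eqVlt => /predU1P[<-//|h1].
    by apply/ltW/g_increasing => //; exact: ltW.
  apply: IVT => //; first exact: continuous_subspaceT.
  by rewrite ge_min le_max D1 D2 orbT.
have [x [xI Dx] xmin] : exists2 x, (1 / T <= x <= alpha) /\ D x = 0 &
    forall y, 1 / T <= y <= alpha -> D y = 0 -> x <= y.
  have [|||x] := @compact_EVT_min R R id (`[1 / T, alpha] `&` [set y | D y = 0])%classic.
  - by exists x1.
  - apply: subclosed_compact (@segment_compact R (1 / T) alpha) _; last by move=> ? [].
    apply: closedI; first exact: itv_closed.
    by apply: (preimage_closed _ (@closed_eq R 0)) => y _; exact: Dcont.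
  - by apply: continuous_subspaceT => y; exact: cvg_id.
  rewrite inE /= in_itv/= => -[xI Dx] xmin; exists x => // y yI Dy.
  by apply: xmin; rewrite inE /= in_itv.
have /andP[b1' b2'] := beta_range x xI; move: xI => /andP[Tx xa].
have x0 : 0 < x by rewrite (lt_le_trans _ Tx)// divr_gt0//; lra.
have gx : g t x = g t (1 - A * x) by apply/eqP; rewrite -subr_eq0 -/(D x) Dx.
have sx : skew_solution t r r.-1 1 x (1 - A * x).
  apply/skewP; split=> //; split; [|lra..].
  have x1' : x < 1 by lra.
  by rewrite -(g_lt0 ht x1') gx g_lt0_right//; lra.
exists x, (1 - A * x); split=> // y z /skewP[[Ty ym mb' _] gy bE].
have y0 : 0 < y by rewrite -(@pmulr_rgt0 _ T); lra.
have [xy|yx] := leP x y; first by apply: g_decreasing_le => //; exact: ltW.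
have : x <= y; last by rewrite leNgt yx.
apply: xmin; first by rewrite inv_succ_le (ltW Ty) (le_trans (ltW yx)).
by rewrite /D -bE gy subrr.
Qed.

Lemma sum_all_but_one (G : R -> R) (rho : 'rV[R]_r) (j : 'I_r) (alpha beta : R) :
  rho 0 j = beta -> (forall i, i != j -> rho 0 i = alpha) ->
  \sum_i G (rho 0 i) = A * G alpha + G beta.
Proof.
move=> rj ri; rewrite (bigD1 j)//= rj addrC; congr (_ + _).
rewrite (eq_bigr (fun=> G alpha)) => [|i /ri->//].
by rewrite sumr_const cardC1 card_ord mulr_natl.
Qed.

Let last_lt : (r.-1 < r)%N. Proof. by rewrite prednK// ltnW. Qed.
Let last := Ordinal last_lt.

Lemma two_valued_pointE (alpha beta : R) (i : 'I_r) :
  two_valued_point r r.-1 alpha beta 0 i = if i == last then beta else alpha.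
Proof.
rewrite mxE -val_eqE /= ltn_neqAle -ltnS prednK ?ltn_ord ?(ltnW hr)// andbT.
by case: eqP.
Qed.

Lemma all_but_one_perm (rho : 'rV[R]_r) (j : 'I_r) (alpha beta : R) :
  rho 0 j = beta -> (forall i, i != j -> rho 0 i = alpha) ->
  eq_up_to_perm rho (two_valued_point r r.-1 alpha beta).
Proof.
move=> rj ri; exists (tperm j last); apply/rowP => i; rewrite [RHS]mxE two_valued_pointE.
have [->|ij] := eqVneq i j; first by rewrite tpermL eqxx.
by rewrite ri// -[X in _ == X](tpermL j last) (inj_eq perm_inj) (negPf ij).
Qed.

Lemma maximizer_classification (rho : 'rV[R]_r) : maximizes_on_simplex t rho ->
  eq_up_to_perm rho (turan_point r) \/
  exists alpha beta : R, largest_skew_solution t r alpha beta /\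
    eq_up_to_perm rho (two_valued_point r r.-1 alpha beta).
Proof.
move=> rhoM; have [[rho0 rho1] rho_le] := rhoM.
have rho_gt0 := maximizer_gt0 ht rhoM.
have slopes := maximizer_equal_slopes ht rhoM.
have T3 := T_ge3; have Tm := @inflectionE R t; have A0 := A_gt0.
have inj_small i k : rho 0 i <= m -> rho 0 k <= m -> rho 0 i = rho 0 k.
  move=> im km; have [lt|lt|//] := ltgtP (rho 0 i) (rho 0 k).
    by have := g_decreasing ht (rho0 i) lt km; rewrite (slopes i k) ltxx.
  by have := g_decreasing ht (rho0 k) lt im; rewrite (slopes i k) ltxx.
have [[j mj]|small] := pselect (exists j, m < rho 0 j); last first.
  left; exists 1%g; apply/rowP => i; rewrite col_perm1 mxE.
  have le_m k : rho 0 k <= m by rewrite leNgt; apply/negP => ?; apply: small; exists k.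
  rewrite -[RHS]mul1r -[X in _ = X * _]rho1 (eq_bigr (fun=> rho 0 i)) => [|k _]; last exact: inj_small.
  rewrite sumr_const card_ord -[_ *+ _]mulr_natr mulfK// pnatr_eq0 -lt0n; exact: ltnW.
right; have small i : i != j -> rho 0 i <= m.
  by move=> ij; rewrite leNgt; apply/negP => mi; rewrite (maximizer_one_large ht rhoM mi mj) eqxx in ij.
(* the common value alpha is read off any coordinate k other than j; r >= 2 *)
have [k kj] : exists k, k != j.
  have : (0 < #|predC1 j|)%N by rewrite cardC1 card_ord -ltnS prednK// ltnW.
  by move=> /card_gt0P[k]; rewrite inE => kj; exists k.
have [alpha aE] : exists u : R, rho 0 k = u by eexists.
have [beta jE] : exists u : R, rho 0 j = u by eexists.
have ri i : i != j -> rho 0 i = alpha by move=> ij; rewrite -aE; apply: inj_small; exact: small.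
have Ab : A * alpha + beta = 1 by rewrite -(sum_all_but_one id jE ri).
have a0 : 0 < alpha by rewrite -aE.
have b1 : beta < 1 by have := mulr_gt0 A0 a0; lra.
have gab : g t alpha = g t beta by rewrite -aE -jE.
rewrite jE in mj.
have m1 : m < 1 by lra.
have gm : g t m < g t beta by apply: g_increasing => //; exact: ltW.
have am : alpha < m.
  by rewrite lt_neqAle -[X in _ && (X <= _)]aE small// andbT; apply: contraTneq gm => <-; rewrite gab ltxx.
have Ta : 1 < T * alpha.
  have a1 : alpha < 1 by lra.
  by rewrite -(g_lt0 ht a1) gab g_lt0_right.
have sk : skew_solution t r r.-1 1 alpha beta by apply/skewP; split=> //; lra.
exists alpha, beta; split; last exact: (all_but_one_perm jE ri).
split=> // x y /skewP[[Tx xm mb' b1'] gx yE].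
(* a skew solution with larger slope has smaller x, hence a larger value of F *)
rewrite leNgt; apply/negP => gax.
have x0 : 0 < x by rewrite -(@pmulr_rgt0 _ T); lra.
have xa : x < alpha.
  rewrite ltNge; apply/negP => ax; move: gax; apply/negP; rewrite -leNgt.
  by apply: g_decreasing_le => //; exact: ltW.
have bE : beta = 1 - A * alpha by lra.
rewrite yE in gx; rewrite bE in gab.
have [two_last two_other] : two_valued_point r r.-1 x y 0 last = y /\
    forall i, i != last -> two_valued_point r r.-1 x y 0 i = x.
  by split=> [|i /negPf il]; rewrite two_valued_pointE ?eqxx ?il.
have /rho_le : in_simplex (two_valued_point r r.-1 x y).
  split=> [i|]; first by rewrite two_valued_pointE; case: ifP => _; lra.
  by rewrite (sum_all_but_one id two_last two_other)/=; lra.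
rewrite /F (sum_all_but_one (f t) two_last two_other).
rewrite (sum_all_but_one (f t) jE ri) leNgt yE bE.
rewrite (profile_decreases ht A0 Tx xa _ gx gab)//; lra.
Qed.

End Skew.

Theorem theorem3p4 (R : realType) (r t : nat) (hr : (2 <= r)%N) (ht : (2 <= t)%N) :
  [/\ (* the maximum exists and is attained, and only at interior critical points *)
      (exists rho : 'rV[R]_r, maximizes_on_simplex t rho) /\
      (forall rho : 'rV[R]_r,
         maximizes_on_simplex t rho -> interior_critical_point t rho),
      (* the two possibilities, up to permutation *)
      forall rho : 'rV[R]_r, maximizes_on_simplex t rho ->
        eq_up_to_perm rho (turan_point r) \/
        exists alpha beta : R, largest_skew_solution t r alpha beta /\
          eq_up_to_perm rho (two_valued_point r r.-1 alpha beta),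
      (* the second possibility is a single, well-defined point *)
      forall alpha beta alpha' beta' : R,
        largest_skew_solution t r alpha beta ->
        largest_skew_solution t r alpha' beta' ->
        alpha = alpha' /\ beta = beta'
    & (exists (a b : nat) (alpha beta : R), skew_solution t r a b alpha beta) ->
      exists alpha beta : R, largest_skew_solution t r alpha beta].
Proof.
split.
- split; first by apply: exists_maximizer; exact: ltnW.
  by move=> rho; exact: maximizer_critical.
- by move=> rho; exact: maximizer_classification.
- exact: largest_skew_unique.
- by move=> [a [b [alpha [beta /exists_largest_skew]]]]; apply.
Qed.
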